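(* Let $\mathbb{K}$ be an algebraically closed field of characteristic $2$. There exist finite dimensional simple Lie superalgebras $\mathfrak g=\mathfrak g_{\bar0}\oplus\mathfrak g_{\bar1}$ over $\mathbb{K}$ whose even part $\mathfrak g_{\bar0}$ is a solvable Lie algebra.
   Context: A Lie superalgebra over a field $\mathbb{K}$ of characteristic $2$ is a superspace $\mathfrak g=\mathfrak g_{\bar0}\oplus\mathfrak g_{\bar1}$, where $\mathfrak g_{\bar0}$ is a Lie algebra, $\mathfrak g_{\bar1}$ is a $\mathfrak g_{\bar0}$-module, and there is a squaring $x\mapsto x^2\in\mathfrak g_{\bar0}$ on $\mathfrak g_{\bar1}$ with $(ax)^2=a^2x^2$ for $a\in\mathbb{K}$, with $[x,y]:=(x+y)^2-x^2-y^2$ bilinear on $\mathfrak g_{\bar1}$, and $[x^2,y]=[x,[x,y]]$ for $x\in\mathfrak g_{\bar1}$, $y\in\mathfrak g$. A Lie superalgebra of dimension $>1$ is simple if it has no proper nonzero ideals (ideals are graded and closed under squaring of their odd elements). *)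

(* Defs.v *)
From HB Require Import structures.
From mathcomp Require Import all_boot all_order all_algebra.

Set Implicit Arguments.
Unset Strict Implicit.
Unset Printing Implicit Defensive.

Import GRing.Theory.
Local Open Scope ring_scope.

Record lieAlgebra (K : fieldType) (V : lmodType K) := LieAlgebra {
  lie_br : V -> V -> V;
  lie_br_linear_r : forall x, linear (lie_br x);
  lie_br_linear_l : forall y, linear (lie_br^~ y);
  lie_br_alt : forall x, lie_br x x = 0;
  lie_br_jacobi : forall x y z,
    lie_br x (lie_br y z) + lie_br y (lie_br z x) + lie_br z (lie_br x y) = 0
}.

(* The bracket on the odd part of a Lie superalgebra is the polarization of   *)
(* the squaring.                                                              *)
Definition polar (V W : zmodType) (sq : V -> W) (x y : V) : W :=
  sq (x + y) - sq x - sq y.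

(* Structures of Lie superalgebra on the superspace g0 (+) g1. The field K is *)
(* meant to have characteristic 2, so the brackets carry no signs: for a in   *)
(* g0 and x in g1, [x, a] = [a, x] = super_act a x. The identity              *)
(* [x^2, y] = [x, [x, y]], for x in g1 and y in g, is stated separately for   *)
(* y in g0 and for y in g1; the general case follows by linearity in y.       *)
Record lieSuperalgebra2 (K : fieldType) (g0 g1 : lmodType K) :=
  LieSuperalgebra2 {
  super_even : lieAlgebra g0;
  super_act : g0 -> g1 -> g1;
  super_sq : g1 -> g0;
  super_act_linear_r : forall a, linear (super_act a);
  super_act_linear_l : forall x, linear (super_act^~ x);
  super_act_br : forall a b x,
    super_act (lie_br super_even a b) x =
      super_act a (super_act b x) - super_act b (super_act a x);
  super_sqZ : forall (c : K) x, super_sq (c *: x) = c ^+ 2 *: super_sq x;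
  super_polar_linear_r : forall x, linear (polar super_sq x);
  super_polar_linear_l : forall y, linear ((polar super_sq)^~ y);
  super_sq_br_even : forall x a,
    lie_br super_even (super_sq x) a = polar super_sq x (super_act a x);
  super_sq_br_odd : forall x y,
    super_act (super_sq x) y = super_act (polar super_sq x y) x
}.

(* The graded subspace I0 (+) I1 is an ideal of g0 (+) g1.                    *)
Definition super_ideal (K : fieldType) (g0 g1 : vectType K)
    (L : lieSuperalgebra2 g0 g1) (I0 : {vspace g0}) (I1 : {vspace g1}) : Prop :=
  [/\ forall a b, b \in I0 -> lie_br (super_even L) a b \in I0,
      forall x b, b \in I0 -> super_act L b x \in I1,
      forall a y, y \in I1 -> super_act L a y \in I1,
      forall x y, y \in I1 -> polar (super_sq L) x y \in I0
    & forall y, y \in I1 -> super_sq L y \in I0].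

Definition super_simple (K : fieldType) (g0 g1 : vectType K)
    (L : lieSuperalgebra2 g0 g1) : Prop :=
  (1 < \dim {:g0} + \dim {:g1})%N /\
  forall (I0 : {vspace g0}) (I1 : {vspace g1}), super_ideal L I0 I1 ->
    (I0 = 0%VS /\ I1 = 0%VS) \/ (I0 = fullv /\ I1 = fullv).

(* [U, U], the span of the brackets of elements of U; by bilinearity the      *)
(* brackets of basis vectors are enough (as for prodv in falgebra).           *)
Definition lie_derived (K : fieldType) (V : vectType K) (L : lieAlgebra V)
    (U : {vspace V}) : {vspace V} :=
  <<[seq lie_br L x y | x <- vbasis U, y <- vbasis U]>>%VS.

Definition lie_solvable (K : fieldType) (V : vectType K) (L : lieAlgebra V) :
    Prop :=
  exists n : nat, iter n (lie_derived L) fullv = 0%VS.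

(* Main.v *)
(* In characteristic 2 the diagonal matrix [h = diag(1, -1)] of sl_2 is the
   identity, so sl_2 is the Heisenberg algebra [[e, f] = h] with [h] central,
   hence nilpotent, while its action on the plane is still faithful and
   irreducible.  The superalgebra osp(1|2), of dimension 3|2, with even part
   sl_2, odd part the plane, and squaring
   [(a x + b y)^2 = a^2 e + b^2 f + a b h], is therefore simple with a solvable
   even part. *)
Require Import Defs.
From HB Require Import structures.
From mathcomp Require Import all_boot all_order all_algebra.
From mathcomp Require Import ring.

Import GRing.Theory.
Local Open Scope ring_scope.

Section Osp12.

Variable K : fieldType.

(* The triple [(p, q, r)] stands for [p e + q f + r h]. *)
Definition heis : vectType K := (K^o * K^o * K^o)%type.
Definition plane : vectType K := (K^o * K^o)%type.

Definition heis_br (A B : heis) : heis :=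
  (0, 0, A.1.1 * B.1.2 - A.1.2 * B.1.1).

(** The matrix with rows [(r, p)] and [(q, r)]: [h] acts as the identity, which is what diag(1, -1)
    becomes in characteristic 2. *)
Definition plane_act (A : heis) (v : plane) : plane :=
  (A.1.1 * v.2 + A.2 * v.1, A.1.2 * v.1 + A.2 * v.2).

Definition plane_sq (v : plane) : heis := (v.1 ^+ 2, v.2 ^+ 2, v.1 * v.2).

Lemma heis_eq (p q r p' q' r' : K) :
  p = p' -> q = q' -> r = r' -> (p, q, r) = (p', q', r') :> heis.
Proof. by move=> -> -> ->. Qed.

Lemma plane_eq (a b a' b' : K) :
  a = a' -> b = b' -> (a, b) = (a', b') :> plane.
Proof. by move=> -> ->. Qed.

Lemma heis_br_linear_r A : linear (heis_br A).
Proof.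
case: A => [[p q] r] c [[p1 q1] r1] [[p2 q2] r2].
by apply: heis_eq; rewrite /= /GRing.scale /=; ring.
Qed.

Lemma heis_br_linear_l B : linear (heis_br^~ B).
Proof.
case: B => [[p q] r] c [[p1 q1] r1] [[p2 q2] r2].
by apply: heis_eq; rewrite /= /GRing.scale /=; ring.
Qed.

Lemma heis_br_alt A : heis_br A A = 0.
Proof. by apply: heis_eq => //; ring. Qed.

(** Brackets are multiples of the central [h], so each term of the Jacobi sum vanishes by itself. *)
Lemma heis_br_br A B C : heis_br A (heis_br B C) = 0.
Proof. by apply: heis_eq => //=; ring. Qed.

Lemma heis_br_jacobi A B C :
  heis_br A (heis_br B C) + heis_br B (heis_br C A) + heis_br C (heis_br A B)
  = 0.
Proof. by rewrite !heis_br_br !addr0. Qed.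

Definition heis_lie : lieAlgebra heis :=
  LieAlgebra heis_br_linear_r heis_br_linear_l heis_br_alt heis_br_jacobi.

Lemma heis_solvable : lie_solvable heis_lie.
Proof.
exists 2%N; apply/eqP; rewrite -subv0 /=; apply/span_subvP.
move=> _ /allpairsP[[A B] /= [_ /vbasis_mem B_in ->]].
(* The first derived algebra lies on the line of [h], so [B] is a multiple of [h] and its bracket
   with [A] is zero. *)
suff /subvP/(_ B B_in): (lie_derived heis_lie fullv <= <[(0, 0, 1)%R : heis]>)%VS.
  case/vlineP=> k ->; rewrite memv0; apply/eqP.
  by apply: heis_eq => //; rewrite /= /GRing.scale /=; ring.
apply/span_subvP => _ /allpairsP[[C D] [_ _ ->]] /=.
apply/vlineP; exists (C.1.1 * D.1.2 - C.1.2 * D.1.1).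
by apply: heis_eq; rewrite /= /GRing.scale /=; ring.
Qed.

Lemma plane_act_linear_r A : linear (plane_act A).
Proof.
case: A => [[p q] r] c [a1 b1] [a2 b2].
by apply: plane_eq; rewrite /= /GRing.scale /=; ring.
Qed.

Lemma plane_act_linear_l v : linear (plane_act^~ v).
Proof.
case: v => [a b] c [[p1 q1] r1] [[p2 q2] r2].
by apply: plane_eq; rewrite /= /GRing.scale /=; ring.
Qed.

Lemma plane_sqZ (c : K) v : plane_sq (c *: v) = c ^+ 2 *: plane_sq v.
Proof.
by case: v => [a b]; apply: heis_eq; rewrite /= /GRing.scale /=; ring.
Qed.

(** In characteristic 2 only the [h] coordinate survives, so brackets of odd elements are
    central. *)
Lemma polar_plane_sq v w :
  polar plane_sq v w =
    (2 * (v.1 * w.1), 2 * (v.2 * w.2), v.1 * w.2 + v.2 * w.1).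
Proof. by case: v w => [a b] [c d]; apply: heis_eq => /=; ring. Qed.

Lemma polar_plane_sq_linear_r v : linear (polar plane_sq v).
Proof.
case: v => [a b] c [a1 b1] [a2 b2]; rewrite !polar_plane_sq.
by apply: heis_eq; rewrite /= /GRing.scale /=; ring.
Qed.

Lemma polar_plane_sq_linear_l w : linear ((polar plane_sq)^~ w).
Proof.
case: w => [a b] c [a1 b1] [a2 b2]; rewrite !polar_plane_sq.
by apply: heis_eq; rewrite /= /GRing.scale /=; ring.
Qed.

Hypothesis charK : 2%N \in [pchar K].

(** Reduces an identity modulo 2 to one that [ring] proves over any commutative ring; [z] is half
    the difference of the two sides. *)
Lemma eq_mod2 (z x y : K) : x = y + 2 * z -> x = y.
Proof. by rewrite (pcharf0 charK) mul0r addr0. Qed.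

Lemma plane_act_br A B v :
  plane_act (heis_br A B) v =
    plane_act A (plane_act B v) - plane_act B (plane_act A v).
Proof.
case: A B v => [[p q] r] [[p' q'] r'] [a b]; apply: plane_eq => /=.
  by ring.
(* Here the action of [h] as 1 rather than -1 on the second basis vector shows: the two sides are
   opposite. *)
by apply: (@eq_mod2 ((p * q' - q * p') * b)); ring.
Qed.

Lemma plane_sq_br_even v A :
  heis_br (plane_sq v) A = polar plane_sq v (plane_act A v).
Proof.
rewrite polar_plane_sq (pcharf0 charK).
case: v A => [a b] [[p q] r]; apply: heis_eq => /=; try by ring.
by apply: (@eq_mod2 (- (b ^+ 2 * p + a * b * r))); ring.
Qed.

Lemma plane_sq_br_odd v w :
  plane_act (plane_sq v) w = plane_act (polar plane_sq v w) v.
Proof.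
rewrite polar_plane_sq (pcharf0 charK).
by case: v w => [a b] [c d]; apply: plane_eq => /=; ring.
Qed.

Definition osp12 : lieSuperalgebra2 heis plane :=
  @LieSuperalgebra2 K heis plane heis_lie plane_act plane_sq
    plane_act_linear_r plane_act_linear_l plane_act_br plane_sqZ
    polar_plane_sq_linear_r polar_plane_sq_linear_l
    plane_sq_br_even plane_sq_br_odd.

(** From a nonzero vector, [e] or [e] after [f] produces some [(c, 0)] with [c] nonzero; [f] then
    gives [(0, c)], and these two span the plane. *)
Lemma plane_act_irr (I : {vspace plane}) :
  (forall A v, v \in I -> plane_act A v \in I) -> I = 0%VS \/ I = fullv.
Proof.
move=> actI.
have [I0|nzI] := eqVneq I 0%VS; [by left | right].
have act_e v : v \in I -> (v.2, 0) \in I.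
  move=> vI; have -> : (v.2, 0) = plane_act (1, 0, 0) v by apply: plane_eq => /=; ring.
  exact: actI.
have act_f v : v \in I -> (0, v.1) \in I.
  move=> vI; have -> : (0, v.1) = plane_act (0, 1, 0) v by apply: plane_eq => /=; ring.
  exact: actI.
have full (c : K) : c != 0 -> (c, 0) \in I -> I = fullv.
  move=> nz_c cI; apply/eqP; rewrite eqEsubv subvf /=.
  apply/subvP => -[a b] _.
  have -> : (a, b) = (a / c) *: ((c, 0) : plane) + (b / c) *: ((0, c) : plane).
    by apply: plane_eq; rewrite /= /GRing.scale /=; field.
  by rewrite memvD ?memvZ ?(act_f _ cI).
have vI := memv_pick I; move: nzI; rewrite -vpick0.
case: (vpick I) vI => a b vI nz_v.
have [b0|nz_b] := eqVneq b 0; last exact: full _ nz_b (act_e _ vI).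
apply: (full a); last exact: act_e (act_f _ vI).
by apply: contraNneq nz_v => a0; rewrite a0 b0.
Qed.

(** The images of the two basis vectors are [(r, q)] and [(p, r)]. *)
Lemma plane_act_faithful A : (forall v, plane_act A v = 0) -> A = 0.
Proof.
case: A => [[p q] r] A0.
have [+ +] := A0 (1, 0); rewrite /= !(mulr0, mulr1, addr0, add0r) => -> ->.
by have [+ _] := A0 (0, 1); rewrite /= !(mulr0, mulr1, addr0, add0r) => ->.
Qed.

Lemma osp12_simple : super_simple osp12.
Proof.
split; first by rewrite !dimvf.
move=> I0 I1 [_ /= actI0 actI1 polarI1 sqI1].
(* The odd part of the ideal is a submodule of the plane. If it is zero, the even part kills the
   plane and vanishes by faithfulness. *)
case: (plane_act_irr I1 actI1) => I1E; [left | right]; split=> //.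
  apply/eqP; rewrite -subv0; apply/subvP => A AI0; rewrite memv0.
  apply/eqP/plane_act_faithful => v; apply/eqP.
  by rewrite -memv0 -I1E actI0.
apply/eqP; rewrite eqEsubv subvf; apply/subvP => -[[p q] r] _.
have inI1 v : v \in I1 by rewrite I1E memvf.
(* If the odd part is everything, the squares of the basis vectors are [e] and [f], and their
   bracket is [h]. *)
have -> : (p, q, r) = p *: plane_sq (1, 0) + q *: plane_sq (0, 1)
                      + r *: polar plane_sq (1, 0) (0, 1) :> heis.
  rewrite polar_plane_sq.
  by apply: heis_eq; rewrite /= /GRing.scale /=; ring.
by rewrite !memvD ?memvZ ?sqI1 ?polarI1.
Qed.

End Osp12.

Theorem mainTheorem4 (K : closedFieldType) (charK : 2%N \in [pchar K]) :
  exists (g0 g1 : vectType K) (L : lieSuperalgebra2 g0 g1),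
    super_simple L /\ lie_solvable (super_even L).
Proof.
exists (heis K), (plane K), (osp12 K charK).
by split; [exact: osp12_simple | exact: heis_solvable].
Qed.
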